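(* Let $\mathcal{C}$ be a prevariety of languages over a finite alphabet $A$. Then $\mathit{SD}(\mathcal{C}) = \mathit{SF}(\mathcal{C})$.
   Context: Fix a finite alphabet $A$; $A^*$ is the set of finite words (with empty word $\varepsilon$), $A^+=A^*\setminus\{\varepsilon\}$, and a language is a subset of $A^*$. A class is a set of languages. A prevariety is a class $\mathcal{C}$ of regular languages containing $\emptyset$ and $A^*$, closed under union, intersection and complement, and closed under quotients: for all $L\in\mathcal{C}$ and $u\in A^*$, the languages $u^{-1}L=\{w \mid uw\in L\}$ and $Lu^{-1}=\{w\mid wu\in L\}$ belong to $\mathcal{C}$. The star-free closure $\mathit{SF}(\mathcal{C})$ is the least class containing $\mathcal{C}$ and all singletons $\{a\}$ for $a\in A$, and closed under union, complement ($K\mapsto A^*\setminus K$) and concatenation ($KL=\{uv\mid u\in K, v\in L\}$). A prefix code is a language $K\subseteq A^+$ with $K\cap KA^+=\emptyset$. For an integer $d\ge 1$, a prefix code $K$ has synchronization delay $d$ if for all $u,v,w\in A^*$, $uvw\in K^+$ and $v\in K^d$ imply $uv\in K^+$; it has bounded synchronization delay if it has synchronization delay $d$ for some $d\ge1$. A concatenation $KL$ is unambiguous if whenever $u,u'\in K$, $v,v'\in L$ and $uv=u'v'$, then $u=u'$ and $v=v'$. $\mathit{SD}(\mathcal{C})$ is the least class containing $\emptyset$ and $\{a\}$ for every $a\in A$, and closed under: intersection with languages of $\mathcal{C}$ (if $K\in\mathit{SD}(\mathcal{C})$ and $L\in\mathcal{C}$ then $K\cap L\in\mathit{SD}(\mathcal{C})$);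 union of disjoint languages; unambiguous concatenation; and Kleene star $K^*$ of languages $K\in\mathit{SD}(\mathcal{C})$ that are prefix codes of bounded synchronization delay. *)

(* Defs.v *)
From mathcomp Require Import all_boot.
Set Implicit Arguments. Unset Strict Implicit. Unset Printing Implicit Defensive.

Section Lang.
Variable A : finType.

Definition word := seq A.
Definition lang := word -> Prop.

Definition lempty : lang := fun _ => False.
Definition lfull : lang := fun _ => True.
Definition lletter (a : A) : lang := fun w => w = [:: a].
Definition lunion (K L : lang) : lang := fun w => K w \/ L w.
Definition linter (K L : lang) : lang := fun w => K w /\ L w.
Definition lcompl (K : lang) : lang := fun w => ~ K w.
Definition lconcat (K L : lang) : lang :=
  fun w => exists u v, w = u ++ v /\ K u /\ L v.
Definition lstar (K : lang) : lang :=
  fun w => exists ws : seq word, w = flatten ws /\ (forall u, u \in ws -> K u).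
Definition lplus (K : lang) : lang :=
  fun w => exists ws : seq word, ws <> [::] /\ w = flatten ws /\
                                 (forall u, u \in ws -> K u).
Definition lpow (K : lang) (d : nat) : lang :=
  fun w => exists ws : seq word, size ws = d /\ w = flatten ws /\
                                 (forall u, u \in ws -> K u).
Definition lquot_left (u : word) (L : lang) : lang := fun w => L (u ++ w).
Definition lquot_right (L : lang) (u : word) : lang := fun w => L (w ++ u).

Inductive regexp : Type :=
| RVoid | REps | RLit of A
| RUnion of regexp & regexp | RCat of regexp & regexp | RStar of regexp.

Fixpoint rlang (r : regexp) : lang :=
  match r with
  | RVoid => lempty
  | REps => fun w => w = [::]
  | RLit a => lletter a
  | RUnion r s => lunion (rlang r) (rlang s)
  | RCat r s => lconcat (rlang r) (rlang s)
  | RStar r => lstar (rlang r)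
  end.

Definition regular (L : lang) : Prop :=
  exists r : regexp, forall w, L w <-> rlang r w.

Definition prevariety (C : lang -> Prop) : Prop :=
  (forall L, C L -> regular L) /\
  C lempty /\ C lfull /\
  (forall K L, C K -> C L -> C (lunion K L)) /\
  (forall K L, C K -> C L -> C (linter K L)) /\
  (forall K, C K -> C (lcompl K)) /\
  (forall L u, C L -> C (lquot_left u L) /\ C (lquot_right L u)).

Definition prefix_code (K : lang) : Prop :=
  (forall w, K w -> w <> [::]) /\
  (forall u v, K u -> v <> [::] -> ~ K (u ++ v)).

Definition sync_delay (K : lang) (d : nat) : Prop :=
  forall u v w, lplus K (u ++ v ++ w) -> lpow K d v -> lplus K (u ++ v).

Definition bounded_sync_delay (K : lang) : Prop :=
  exists d, 1 <= d /\ sync_delay K d.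

Definition unambiguous_concat (K L : lang) : Prop :=
  forall u u' v v', K u -> K u' -> L v -> L v' -> u ++ v = u' ++ v' ->
    u = u' /\ v = v'.

Definition disjoint_langs (K L : lang) : Prop := forall w, ~ (K w /\ L w).

Inductive SF (C : lang -> Prop) : lang -> Prop :=
| SF_base L : C L -> SF C L
| SF_letter a : SF C (lletter a)
| SF_union K L : SF C K -> SF C L -> SF C (lunion K L)
| SF_compl K : SF C K -> SF C (lcompl K)
| SF_concat K L : SF C K -> SF C L -> SF C (lconcat K L).

Inductive SD (C : lang -> Prop) : lang -> Prop :=
| SD_empty : SD C lempty
| SD_letter a : SD C (lletter a)
| SD_inter K L : SD C K -> C L -> SD C (linter K L)
| SD_union K L : SD C K -> SD C L -> disjoint_langs K L -> SD C (lunion K L)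
| SD_concat K L : SD C K -> SD C L -> unambiguous_concat K L ->
                  SD C (lconcat K L)
| SD_star K : SD C K -> prefix_code K -> bounded_sync_delay K ->
              SD C (lstar K).

End Lang.

(* Main.v *)
Require Import Defs.
From mathcomp Require Import all_boot.
From mathcomp Require Import boolp zify.
Set Implicit Arguments. Unset Strict Implicit. Unset Printing Implicit Defensive.

(** A star-free description of K^* for a prefix code K of delay d only has to forbid
    a block of K^d followed by something other than a factor of K or the end of the
    word, which gives SD(C) in SF(C).

    Conversely, each L in SF(C) has finite index, and there is a congruence eta of
    finite index with classes in C such that all words u with eta(uu) = eta(u) act
    aperiodically on L.  Let A^* act on the states of the minimal automaton of L.
    For a prefix code P of bounded synchronization delay and a set X of states stable
    under P, suppose that the words of P inducing a given map on X always form a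
    language of SD(C); then so do the words of P^* inducing a given map on X.  The
    induction is on |X| and the number of maps induced by P.  If P acts on X by
    permutations, aperiodicity shows that the map induced by a word of P^* depends
    only on its image under eta, so intersections with languages of C suffice.
    Otherwise some words of P induce a map c that is not injective on X.  Let Out be
    the rest of P, and let K be Out^* followed by the words inducing c: then P^* is
    the unambiguous product K^* Out^*, where Out induces fewer maps and K is a prefix
    code of bounded delay acting on the smaller set c(X).  P = A gives the theorem. *)

(** * Words, powers and factorizations over a prefix code *)

Section Words.
Variable A : finType.
Implicit Types (K L P : lang A) (u v w x y : word A) (ws : seq (word A)).

Definition wpow u n : word A := flatten (nseq n u).

Lemma wpowD u i j : wpow u (i + j) = wpow u i ++ wpow u j.
Proof. by rewrite /wpow nseqD flatten_cat. Qed.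

Lemma wpowS u n : wpow u n.+1 = u ++ wpow u n.
Proof. by []. Qed.

Lemma wpow1 u : wpow u 1 = u.
Proof. exact: cats0. Qed.

Lemma wpow_nil n : wpow [::] n = [::].
Proof. by elim: n. Qed.

Lemma size_wpow u n : size (wpow u n) = n * size u.
Proof. by elim: n => // n IH; rewrite wpowS size_cat IH mulSn. Qed.

Lemma cat_eq_cat (T : Type) (a b c d : seq T) : a ++ b = c ++ d ->
  (exists s, a = c ++ s /\ d = s ++ b) \/ (exists s, c = a ++ s /\ b = s ++ d).
Proof.
elim: a c => [|x a IH] [|z c] /= E.
- by left; exists [::].
- by right; exists (z :: c).
- by left; exists (x :: a).
- case: E => <- /IH [] [s [-> ->]]; [left|right]; by exists s.
Qed.

Lemma wpow_cat_eq u n y k l : wpow u n ++ y = k ++ l ->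
  (exists i j u1 u2, [/\ n = (i + j).+1, u = u1 ++ u2, k = wpow u i ++ u1
                       & l = u2 ++ wpow u j ++ y])
  \/ (exists y1, k = wpow u n ++ y1 /\ y = y1 ++ l).
Proof.
elim: n k => [|n IH] k; first by move=> /= ->; right; exists k.
rewrite wpowS -catA => /cat_eq_cat [] [s [E1 E2]].
- by left; exists 0, n, k, s; split.
- case: (IH _ E2) => [[i [j [u1 [u2 [En Eu Es El]]]]]|[y1 [Es Ey]]].
  + left; exists i.+1, j, u1, u2; split=> //; first by rewrite En.
    by rewrite E1 Es wpowS -catA.
  + by right; exists y1; split; rewrite // E1 Es catA.
Qed.

Lemma lang_ext K L : (forall w, K w <-> L w) -> K = L.
Proof. by move/predeqP. Qed.

Lemma lstar_nil K : lstar K [::].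
Proof. by exists [::]. Qed.

Lemma lstar_cat K u v : lstar K u -> lstar K v -> lstar K (u ++ v).
Proof.
move=> [ws [-> H]] [ws' [-> H']]; exists (ws ++ ws'); split.
  by rewrite flatten_cat.
by move=> x; rewrite mem_cat => /orP [/H|/H'].
Qed.

Lemma lstar_word K u : K u -> lstar K u.
Proof.
move=> Ku; exists [:: u]; split; first by rewrite /= cats0.
by move=> v; rewrite inE => /eqP ->.
Qed.

Lemma lstar_ind K (Q : word A -> Prop) : Q [::] ->
  (forall u v, K u -> lstar K v -> Q v -> Q (u ++ v)) ->
  forall w, lstar K w -> Q w.
Proof.
move=> Q0 QS w [ws [-> H]]; elim: ws H => //= u ws IH H.
have H' v : v \in ws -> K v by move=> vws; apply: H; rewrite inE vws orbT.
apply: QS; [by apply: H; rewrite inE eqxx|by exists ws|exact: IH].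
Qed.

Lemma lstar_mono K L : (forall w, K w -> L w) -> forall w, lstar K w -> lstar L w.
Proof. by move=> KL w [ws [-> H]]; exists ws; split=> // u /H /KL. Qed.

Lemma lstar_idem K L : (forall w, K w -> lstar L w) ->
  forall w, lstar K w -> lstar L w.
Proof.
move=> KL; apply: lstar_ind; first exact: lstar_nil.
by move=> u v /KL Lu _; apply: lstar_cat.
Qed.

Lemma lplus_lstar K w : lplus K w -> lstar K w.
Proof. by move=> [ws [_ H]]; exists ws. Qed.

Lemma lstar_lplus K w : w <> [::] -> lstar K w -> lplus K w.
Proof. by move=> w0 [ws [E H]]; exists ws; split=> // ws0; rewrite ws0 in E. Qed.

Lemma lpow_S K n w : lpow K n.+1 w <-> lconcat K (lpow K n) w.
Proof.
split=> [[[|u ws] [//= [Es] [-> H]]]|[u [v [-> [Ku [ws [Es [-> H]]]]]]]].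
  exists u, (flatten ws); split=> //; split; first by apply: H; rewrite inE eqxx.
  by exists ws; split=> //; split=> // v vws; apply: H; rewrite inE vws orbT.
exists (u :: ws); split; first by rewrite /= Es.
by split=> // x; rewrite inE => /orP [/eqP ->|/H].
Qed.

Lemma lpow_lstar K n w : lpow K n w -> lstar K w.
Proof. by move=> [ws [_ H]]; exists ws. Qed.

Lemma lpow_cat K i j u v : lpow K i u -> lpow K j v -> lpow K (i + j) (u ++ v).
Proof.
move=> [ws [E [-> H]]] [ws' [E' [-> H']]]; exists (ws ++ ws'); split.
  by rewrite size_cat E E'.
split; first by rewrite flatten_cat.
by move=> x; rewrite mem_cat => /orP [/H|/H'].
Qed.

Lemma lpowD K i j w : lpow K (i + j) w ->
  exists u v, w = u ++ v /\ lpow K i u /\ lpow K j v.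
Proof.
move=> [ws [E [-> H]]]; exists (flatten (take i ws)), (flatten (drop i ws)).
rewrite -flatten_cat cat_take_drop; split=> //; split.
- exists (take i ws); split; first by rewrite size_takel // E leq_addr.
  by split=> // u /mem_take /H.
- exists (drop i ws); split; first by rewrite size_drop E addKn.
  by split=> // u /mem_drop /H.
Qed.

Lemma lstar_lpow K w : lstar K w -> exists n, lpow K n w.
Proof. by move=> [ws H]; exists (size ws), ws. Qed.

Lemma prefix_code_unambiguous P L : prefix_code P -> unambiguous_concat P L.
Proof.
move=> [_ Pp] u u' v v' Pu Pu' _ _ E.
have Euu' : forall s v v', P v -> P v' -> v = v' ++ s -> v = v'.
  move=> [|a s] w w' Pw Pw' Ew; first by rewrite Ew cats0.
  by case: (Pp w' (a :: s) Pw') => //; rewrite -Ew.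
have Eu : u = u'.
  by case: (cat_eq_cat E) => [] [s [Es _]]; [|symmetry]; apply: Euu' Es.
by rewrite Eu in E *; move/eqP: E; rewrite eqseq_cat // eqxx => /eqP.
Qed.

(** Both sides start with a factor of the prefix code, so these two factors agree and can be
    cancelled; [x] may be any word. *)
Lemma code_factorization_prefix P ws ws' x : prefix_code P ->
  (forall u, u \in ws -> P u) -> (forall u, u \in ws' -> P u) ->
  flatten ws ++ x = flatten ws' -> exists s, ws' = ws ++ s.
Proof.
move=> codeP; elim: ws ws' => [|u ws IH] ws' H H' E; first by exists ws'.
have Pu : P u by apply: H; rewrite inE eqxx.
case: ws' H' E => [|u' ws'] H' /=.
  by case: u Pu {H} => // /(proj1 codeP).
have Pu' : P u' by apply: H'; rewrite inE eqxx.
rewrite -catA => /(prefix_code_unambiguous (L := @lfull A) codeP Pu Pu' I I) [-> E].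
have [||s ->] := IH ws' _ _ E.
- by move=> v vw; apply: H; rewrite inE vw orbT.
- by move=> v vw; apply: H'; rewrite inE vw orbT.
by exists s.
Qed.

Lemma code_factorization_inj P ws ws' : prefix_code P ->
  (forall u, u \in ws -> P u) -> (forall u, u \in ws' -> P u) ->
  flatten ws = flatten ws' -> ws = ws'.
Proof.
move=> codeP H H' E.
case: (@code_factorization_prefix P ws ws' [::] codeP H H'); first by rewrite cats0.
case=> [|v s] Es; first by rewrite Es cats0.
have Pv : P v by apply: H'; rewrite Es mem_cat inE eqxx orbT.
move: (congr1 size E); rewrite Es flatten_cat size_cat /= size_cat.
by case: v Pv {Es} => [/(proj1 codeP)//|a v] _ /=; lia.
Qed.

(** The last [d] of the [n] factors suffice; the first [n - d] join the left context. *)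
Lemma sync_delay_ge P d n u v w : sync_delay P d -> d <= n ->
  lplus P (u ++ v ++ w) -> lpow P n v -> lplus P (u ++ v).
Proof.
move=> sd dn H; rewrite -(subnK dn) => /lpowD [v1 [v2 [Ev [_ Pv2]]]].
by rewrite Ev catA; apply: (sd (u ++ v1) v2 w) => //; rewrite -catA [v1 ++ _]catA -Ev.
Qed.

End Words.

(** * SD(C) is contained in SF(C) *)

Section SDinSF.
Variables (A : finType) (C : lang A -> Prop).
Hypothesis prevC : prevariety C.
Implicit Types (K L : lang A).

Lemma SF_ext K L : (forall w, K w <-> L w) -> SF C K -> SF C L.
Proof. by move/lang_ext ->. Qed.

Lemma SF_full : SF C (@lfull A).
Proof. by apply: SF_base; case: prevC => _ [_ []]. Qed.

Lemma SF_empty : SF C (@lempty A).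
Proof. by apply: SF_base; case: prevC => _ []. Qed.

Lemma SF_inter K L : SF C K -> SF C L -> SF C (linter K L).
Proof.
move=> FK FL.
apply: SF_ext (SF_compl (SF_union (SF_compl FK) (SF_compl FL))) => w.
rewrite /lcompl /lunion /linter; split=> [H|[Kw Lw] []//].
by split; apply: contrapT => ?; apply: H; [left|right].
Qed.

(** A word is empty exactly when no letter begins it. *)
Lemma SF_nil : SF C (fun w => w = [::]).
Proof.
have FA (s : seq A) : SF C (fun w => exists a v, a \in s /\ w = a :: v).
  elim: s => [|a s IH].
    by apply: SF_ext SF_empty => w; split=> // [] [a [v []]].
  apply: SF_ext (SF_union (SF_concat (SF_letter C a) SF_full) IH) => w.
  split=> [[[_ [v [-> [-> _]]]]|[b [v [bs ->]]]]|[b [v []]]].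
  - by exists a, v; rewrite inE eqxx.
  - by exists b, v; rewrite inE bs orbT.
  - rewrite inE => /orP [/eqP -> ->|bs ->]; first by left; exists [:: a], v.
    by right; exists b, v.
apply: SF_ext (SF_compl (FA (enum A))) => -[|a w]; split=> //.
- by move=> _ [a [v []]].
- by case; exists a, w; rewrite mem_enum.
Qed.

Lemma SF_lpow K n : SF C K -> SF C (lpow K n).
Proof.
move=> FK; elim: n => [|n IH].
  apply: SF_ext SF_nil => w; split=> [->|[ws [/size0nil -> [-> _]]]] //.
  by exists [::].
by apply: SF_ext (SF_concat FK IH) => w; rewrite lpow_S.
Qed.

Lemma SF_lpow_lt K d : SF C K -> SF C (fun w => exists2 i, i < d & lpow K i w).
Proof.
move=> FK; elim: d => [|d IH].
  by apply: SF_ext SF_empty => w; split=> // [] [].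
apply: SF_ext (SF_union IH (SF_lpow d FK)) => w; split.
  by case=> [[i id Ki]|Kd]; [exists i => //; exact: ltnW|exists d].
move=> [i]; rewrite ltnS leq_eqVlt => /orP [/eqP -> Kd|id Ki]; first by right.
by left; exists i.
Qed.

(* With delay d, a word with at least d factors lies in K^* exactly when it starts
   in K^d and each occurrence of a block of K^d is followed either by the end of
   the word or by one more factor of K. *)
Lemma SF_star K : SF C K -> prefix_code K -> bounded_sync_delay K -> SF C (lstar K).
Proof.
move=> FK codeK [d [_ sd]].
pose bad := lconcat (@lfull A)
  (lconcat (lpow K d) (lcompl (lunion (fun w => w = [::]) (lconcat K (@lfull A))))).
have FX : SF C (lunion (fun w => exists2 i, i < d & lpow K i w)
    (linter (lconcat (lpow K d) (@lfull A)) (lcompl bad))).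
  apply: SF_union; first exact: SF_lpow_lt.
  apply: SF_inter; first exact: SF_concat (SF_lpow d FK) SF_full.
  apply: SF_compl; apply: SF_concat SF_full _; apply: SF_concat (SF_lpow d FK) _.
  by apply: SF_compl; apply: SF_union SF_nil (SF_concat FK SF_full).
apply: SF_ext FX => w; split=> [[[i _ /lpow_lstar//]|[]]|].
- move=> [v [x [-> [Kv _]]]] nb.
  have nb' u v' x' : v ++ x = u ++ v' ++ x' -> lpow K d v' ->
      x' = [::] \/ lconcat K (@lfull A) x'.
    move=> E Kv'; apply: contrapT => nx'; apply: nb.
    by exists u, (v' ++ x'); split=> //; split=> //; exists v', x'.
  (* [q] is a window of [d] factors that slides to the right, and [p] collects what it leaves
     behind; the induction is on the length of what follows. *)
  have [p [q [Ev [Kp Kq]]]] : exists p q, v = p ++ q /\ lstar K p /\ lpow K d q.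
    by exists [::], v; split=> //; split=> //; exact: lstar_nil.
  rewrite Ev -catA; rewrite Ev -catA in nb'; apply: lstar_cat Kp _.
  have [n xn] := ubnP (size x); elim: n x p q Kq nb' xn {Ev Kv nb} => // n IH x p q Kq nb' xn.
  case: (nb' p q x erefl Kq) => [->|[k [y [Ex [Kk _]]]]].
    by rewrite cats0; apply: lpow_lstar Kq.
  have/lpow_S [q1 [q2 [Eq [Kq1 Kq2]]]] : lpow K d.+1 (q ++ k).
    rewrite -addn1; apply: lpow_cat Kq _; exists [:: k]; rewrite /= cats0.
    by split=> //; split=> // z; rewrite inE => /eqP ->.
  have Eqx : q ++ x = q1 ++ q2 ++ y by rewrite Ex !catA Eq.
  rewrite Eqx; apply: lstar_cat (lstar_word Kq1) _.
  apply: (IH y (p ++ q1) q2) => //.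
    by move=> u v' x' E; apply: nb'; rewrite Eqx catA E.
  have := proj1 codeK _ Kk; move: xn; rewrite Ex size_cat.
  by case: (k) => //= a s; lia.
- move=> Kw; have [ws [Ew H]] := Kw; case: (ltnP (size ws) d) => sz.
    by left; exists (size ws) => //; exists ws.
  right; split.
    have : lpow K (size ws) w by exists ws.
    rewrite -(subnKC sz) => /lpowD [u [v [-> [Ku _]]]].
    by exists u, v.
  move=> [u [z [E [_ [v [x [Ez [Kv nx]]]]]]]]; rewrite {z}Ez in E; apply: nx.
  case: (EM (w = [::])) => [w0|w0].
    by left; move: E; rewrite w0; case: u => //; case: v {Kv} => //; case: x.
  (* The delay puts [u ++ v] in K^+, so its factors are the first factors of [w], and [x] is empty
     or starts with the next one. *)
  have := lstar_lplus w0 Kw; rewrite E => /sd /(_ Kv) [ws' [_ [E' H']]].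
  have [|s Es] := @code_factorization_prefix _ K ws' ws x codeK H' H.
    by rewrite -E' -catA -E.
  case: s Es => [|k s] Es.
    left; rewrite Es cats0 in Ew; move: (congr1 size Ew).
    by rewrite E -E' !size_cat; case: x {E} => //= a x; lia.
  right; exists k, (flatten s); split; last first.
    by split=> //; apply: H; rewrite Es mem_cat inE eqxx orbT.
  move: Ew; rewrite E Es flatten_cat -E' catA /= => /eqP.
  by rewrite eqseq_cat // => /andP [_ /eqP].
Qed.

Lemma SD_sub_SF L : SD C L -> SF C L.
Proof.
elim=> {L} [|a|K L _ FK CL|K L _ FK _ FL _|K L _ FK _ FL _|K _ FK codeK sdK].
- exact: SF_empty.
- exact: SF_letter.
- exact: SF_inter FK (SF_base CL).
- exact: SF_union.
- exact: SF_concat.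
- exact: SF_star.
Qed.

End SDinSF.

(** * Languages of finite index and syntactic congruences *)

Section FiniteIndex.
Variable A : finType.
Implicit Types (K L : lang A) (u v w x y : word A).

(** The kernel of [f] refines [E]; applying [f] to one chosen representative per class makes the
    kernel equal to [E]. *)
Lemma finite_quotient (E : word A -> word A -> Prop) (Q : finType) (f : word A -> Q) :
  (forall u, E u u) -> (forall u v, E u v -> E v u) ->
  (forall u v w, E u v -> E v w -> E u w) ->
  (forall u v, f u = f v -> E u v) ->
  exists g : word A -> Q, forall u v, g u = g v <-> E u v.
Proof.
move=> Er Es Et fE.
pose rep u : word A := choose (fun v => `[< E u v >]) u.
have repP u : E u (rep u) by apply/asboolP/(@chooseP _ (fun v => `[< E u v >])); apply/asboolP.
exists (f \o rep) => u v; split=> [/fE H|Euv].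
  exact: Et (repP u) (Et _ _ _ H (Es _ _ (repP v))).
congr f; rewrite /rep.
have Epred : (fun w => `[< E u w >]) =1 (fun w => `[< E v w >]).
  by move=> w; apply: asbool_equiv_eq; split=> H; [apply: Et (Es _ _ Euv) H|apply: Et Euv H].
rewrite (eq_choose Epred u); apply: choose_id; apply/asboolP => //.
exact: Es.
Qed.

Lemma finite_section (Q : finType) (f : word A -> Q) :
  exists r : Q -> word A, forall x, f (r (f x)) = f x.
Proof.
have /choice [r Hr] (q : Q) : exists x, (exists y, f y = q) -> f x = q.
  by case: (EM (exists y, f y = q)) => [[y Ey]|nq]; [exists y|exists [::]].
by exists r => x; apply: Hr; exists x.
Qed.

(** The kernel of [f] refines the Nerode congruence of [L]; one implication suffices since
    [f u = f v] is symmetric. *)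
Definition finite_index L := exists (Q : finType) (f : word A -> Q),
  forall u v, f u = f v -> forall w, L (u ++ w) -> L (v ++ w).

Lemma finite_index_union K L :
  finite_index K -> finite_index L -> finite_index (lunion K L).
Proof.
move=> [QK [f Hf]] [QL [g Hg]]; exists (QK * QL)%type, (fun u => (f u, g u)).
by move=> u v [Ef Eg] w [/(Hf _ _ Ef)|/(Hg _ _ Eg)]; [left|right].
Qed.

Lemma finite_index_compl K : finite_index K -> finite_index (lcompl K).
Proof.
move=> [Q [f Hf]]; exists Q, f => u v E w nK Kv; apply: nK.
exact: Hf (esym E) _ Kv.
Qed.

(** Subset construction: to the value of [u] for [K] add the values for [L] of all that remains of
    [u] after a prefix in [K]. *)
Lemma finite_index_concat K L :
  finite_index K -> finite_index L -> finite_index (lconcat K L).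
Proof.
move=> [QK [f Hf]] [QL [g Hg]].
pose S u := [set q : QL | `[< exists k s, u = k ++ s /\ K k /\ g s = q >]].
exists (QK * {set QL})%type, (fun u => (f u, S u)) => u v [Ef ES] w.
move=> [k [l [/cat_eq_cat [] [s [E1 E2]] [Kk Ll]]]].
- have : g s \in S u by rewrite inE; apply/asboolP; exists k, s.
  rewrite ES inE => /asboolP [k' [s' [-> [Kk' Eg]]]].
  exists k', (s' ++ w); split; first by rewrite catA.
  by split=> //; apply: Hg (esym Eg) _ _; rewrite -E2.
- exists (v ++ s), l; split; first by rewrite E2 catA.
  by split=> //; apply: Hf Ef _ _; rewrite -E1.
Qed.

(** [s ++ w1] is the factor that contains the last letter of [u], which exists since [u] is not
    empty. *)
Lemma lstar_cut K u w : u <> [::] -> lstar K (u ++ w) ->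
  exists k s w1 w2, [/\ u = k ++ s, w = w1 ++ w2, lstar K k, K (s ++ w1) & lstar K w2].
Proof.
move=> u0 H; have [z Ez] : exists z, z = u ++ w by exists (u ++ w).
rewrite -Ez in H; move: z H u u0 w Ez; apply: lstar_ind => [[]//|].
move=> p z Kp Kz IH u u0 w /esym /cat_eq_cat [] [s [E1 E2]]; last first.
  by exists [::], u, s, z; rewrite -E1; split=> //; exact: lstar_nil.
case: (EM (s = [::])) => [s0|s0].
  rewrite s0 /= in E1 E2; rewrite cats0 in E1; exists [::], u, [::], w.
  by rewrite cats0 E1 -E2; split=> //; exact: lstar_nil.
case: (IH s s0 w E2) => k [s' [w1 [w2 [Es Ew Kk Ks Kw2]]]].
exists (p ++ k), s', w1, w2; split=> //; first by rewrite E1 Es catA.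
exact: lstar_cat (lstar_word Kp) Kk.
Qed.

(** The same subset construction with prefixes in K^*; the Boolean isolates the empty word, where
    [lstar_cut] does not apply. *)
Lemma finite_index_star K : finite_index K -> finite_index (lstar K).
Proof.
move=> [Q [f Hf]].
pose S u := [set q : Q | `[< exists k s, u = k ++ s /\ lstar K k /\ f s = q >]].
exists (bool * {set Q})%type, (fun u => (u == [::], S u)) => u v [E0 ES] w.
case: (eqVneq u [::]) => [u0|/eqP u0].
  by move: E0; rewrite u0 eqxx => /esym /eqP ->.
case/(lstar_cut u0) => k [s [w1 [w2 [Eu -> Kk Ks Kw2]]]].
have : f s \in S u by rewrite inE; apply/asboolP; exists k, s.
rewrite ES inE => /asboolP [k' [s' [-> [Kk' Ef]]]].
rewrite -catA; apply: lstar_cat Kk' _; rewrite catA; apply: lstar_cat Kw2.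
by apply: lstar_word; apply: Hf (esym Ef) _ _.
Qed.

Lemma finite_index_letter a : finite_index (@lletter A a).
Proof.
exists (bool * bool)%type, (fun u => (u == [::], u == [:: a])) => u v [E0 Ea] w.
case: (eqVneq u [::]) E0 => [-> /esym /eqP -> //|u0 _].
case: (eqVneq u [:: a]) Ea => [-> /esym /eqP -> //|ua _].
rewrite /lletter; case: u u0 ua => // b [|c u] //= _ ba [Eb].
by rewrite Eb eqxx in ba.
Qed.

Lemma finite_index_regular L : regular L -> finite_index L.
Proof.
case=> r /lang_ext ->; elim: r => [||a|r IHr s IHs|r IHr s IHs|r IHr] /=.
- by exists unit, (fun=> tt).
- exists bool, (fun u => u == [::]) => u v.
  by case: u => [|a u] //=; move=> /esym /eqP ->.
- exact: finite_index_letter.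
- exact: finite_index_union.
- exact: finite_index_concat.
- exact: finite_index_star.
Qed.

Definition syn L u v := forall x y, L (x ++ u ++ y) <-> L (x ++ v ++ y).

(** Words that induce the same map on the values of [f], each value being replaced by a word that
    takes it, are equivalent; there are finitely many such maps. *)
Lemma finite_index_syn L : finite_index L ->
  exists (M : finType) (g : word A -> M), forall u v, g u = g v <-> syn L u v.
Proof.
move=> [Q [f Hf]].
have [r Hr] := finite_section f.
exists {ffun Q -> Q}; apply: (@finite_quotient _ _ (fun u => [ffun q => f (r q ++ u)])).
- by [].
- by move=> u v H x y; rewrite H.
- by move=> u v w H1 H2 x y; rewrite H1 H2.
have H u v : [ffun q => f (r q ++ u)] = [ffun q => f (r q ++ v)] ->
    forall x y, L (x ++ u ++ y) -> L (x ++ v ++ y).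
  move=> /ffunP E x y /(Hf _ _ (esym (Hr x))).
  rewrite catA => /(Hf _ (r (f x) ++ v)).
  have := E (f x); rewrite !ffunE => -> /(_ erefl).
  by rewrite -catA => /(Hf _ _ (Hr x)).
by move=> u v E x y; split; apply: H.
Qed.

End FiniteIndex.

(** * Aperiodicity relative to congruences with classes in C *)

Section Control.
Variables (A : finType) (C : lang A -> Prop).
Hypothesis prevC : prevariety C.
Implicit Types (K L : lang A) (u v w x y : word A).

Lemma C_ext K L : (forall w, K w <-> L w) -> C K -> C L.
Proof. by move/lang_ext ->. Qed.

Lemma C_bigunion (I : finType) (F : I -> lang A) :
  (forall i, C (F i)) -> C (fun w => exists i, F i w).
Proof.
case: prevC => _ [C0 [_ [CU _]]] CF.
have H (s : seq I) : C (fun w => exists2 i, i \in s & F i w).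
  elim: s => [|i s IH]; first by apply: C_ext C0 => w; split=> // [] [].
  apply: C_ext (CU _ _ (CF i) IH) => w; split.
    by case=> [Fi|[j js Fj]]; [exists i|exists j] => //; rewrite inE ?eqxx ?js ?orbT.
  case=> j; rewrite inE => /orP [/eqP -> Fi|js Fj]; first by left.
  by right; exists j.
apply: C_ext (H (enum I)) => w; split=> [[i _ Fi]|[i Fi]]; exists i => //.
by rewrite mem_enum.
Qed.

Lemma C_compl K : C K -> C (lcompl K).
Proof. by case: prevC => _ [_ [_ [_ [_ []]]]] H _; apply: H. Qed.

Lemma C_bigcap (I : finType) (F : I -> lang A) :
  (forall i, C (F i)) -> C (fun w => forall i, F i w).
Proof.
move=> CF; have := C_compl (C_bigunion (fun i => C_compl (CF i))).
apply: C_ext => w; split=> [H i|H [i]]; last by apply.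
by apply: contrapT => nF; apply: H; exists i.
Qed.

Definition congruence (N : finType) (eta : word A -> N) := forall u u' v v',
  eta u = eta u' -> eta v = eta v' -> eta (u ++ v) = eta (u' ++ v').

(** A morphism to a finite monoid with fibres in C, its product being left implicit in
    [congruence]. *)
Definition C_morphism (N : finType) (eta : word A -> N) :=
  congruence eta /\ forall n, C (fun w => eta w = n).

Lemma C_morphism_pred (N : finType) (eta : word A -> N) (S : N -> Prop) :
  C_morphism eta -> C (fun w => S (eta w)).
Proof.
case: prevC => _ [C0 _] [_ Ceta].
apply: (@C_ext (fun w => exists n, S n /\ eta w = n)).
  by move=> w; split=> [[n [Sn ->]]|Sn]; [|exists (eta w)].
apply: C_bigunion => n; case: (EM (S n)) => Sn.
  by apply: C_ext (Ceta n) => w; split=> // [[]].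
by apply: C_ext C0 => w; split=> // [[]].
Qed.

(* The words whose image under eta is idempotent act aperiodically on L: this is
   the aperiodicity of the C-orbits of the syntactic morphism of L. *)
Definition aperiodic_over (N : finType) (eta : word A -> N) n L :=
  forall u x y, eta (u ++ u) = eta u -> forall i j, n <= i -> n <= j ->
    L (x ++ wpow u i ++ y) -> L (x ++ wpow u j ++ y).

Definition C_aperiodic L := exists (N : finType) (eta : word A -> N),
  C_morphism eta /\ exists n, aperiodic_over eta n L.

Lemma C_aperiodic2 K L : C_aperiodic K -> C_aperiodic L ->
  exists (N : finType) (eta : word A -> N), C_morphism eta /\
    exists n, aperiodic_over eta n K /\ aperiodic_over eta n L.
Proof.
move=> [N1 [e1 [[c1 C1] [n1 a1]]]] [N2 [e2 [[c2 C2] [n2 a2]]]].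
exists (N1 * N2)%type, (fun w => (e1 w, e2 w)); split.
  split=> [u u' v v' [E1 E2] [E1' E2']|[m1 m2]]; first by congr pair; auto.
  case: prevC => _ [_ [_ [_ [CI _]]]].
  by apply: C_ext (CI _ _ (C1 m1) (C2 m2)) => w; split=> [[-> ->]|[]].
exists (n1 + n2); split=> u x y [E1 E2] i j ni nj; [apply: a1|apply: a2] => //; lia.
Qed.

Lemma C_aperiodic_union K L :
  C_aperiodic K -> C_aperiodic L -> C_aperiodic (lunion K L).
Proof.
move=> aK /(C_aperiodic2 aK) [N [e [Ce [n [{}aK aL]]]]].
exists N, e; split=> //; exists n => u x y E i j ni nj.
by case=> [/(aK _ _ _ E i j ni nj)|/(aL _ _ _ E i j ni nj)]; [left|right].
Qed.

Lemma C_aperiodic_compl K : C_aperiodic K -> C_aperiodic (lcompl K).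
Proof.
move=> [N [e [Ce [n aK]]]]; exists N, e; split=> //; exists n => u x y E i j ni nj nK.
by move/(aK _ _ _ E j i nj ni).
Qed.

(** The cut between the two factors breaks at most one copy of [u]. Out of 2n+1 copies, at least [n]
    stay intact on one side, where their number can vary freely above [n]. *)
Lemma C_aperiodic_concat K L :
  C_aperiodic K -> C_aperiodic L -> C_aperiodic (lconcat K L).
Proof.
move=> aK /(C_aperiodic2 aK) [N [e [Ce [n [{}aK aL]]]]].
exists N, e; split=> //; exists (n + n).+1 => u x y E i j ni nj.
have ni' : n <= i by lia.
have nj' : n <= j by lia.
move=> [k [l [/cat_eq_cat [] [s [E1 E2]] [Kk Ll]]]].
  exists k, (s ++ wpow u j ++ y); split; first by rewrite E1 !catA.
  by split=> //; apply: (aL _ _ _ E i j ni' nj'); rewrite -E2.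
case: (wpow_cat_eq E2) => [[i1 [i2 [u1 [u2 [Ei Eu Es El]]]]]|[y1 [Es Ey]]]; last first.
  exists (x ++ wpow u j ++ y1), l; split; first by rewrite Ey !catA.
  by split=> //; apply: (aK _ _ _ E i j ni' nj'); rewrite -Es -E1.
rewrite E1 Es in Kk; rewrite El in Ll.
suff [j1 [j2 [Ej [K1 L2]]]] : exists j1 j2, j = (j1 + j2).+1 /\
    K (x ++ wpow u j1 ++ u1) /\ L (u2 ++ wpow u j2 ++ y).
  exists (x ++ wpow u j1 ++ u1), (u2 ++ wpow u j2 ++ y); split=> //.
  by rewrite Ej -addnS wpowD wpowS -!catA; congr (_ ++ (_ ++ _)); rewrite {1}Eu -catA.
case: (leqP n i1) => n1; case: (leqP n i2) => n2; last lia.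
- exists n, (j - n.+1); split; first lia.
  by split; [apply: (aK _ _ _ E i1)|apply: (aL _ _ _ E i2)] => //; lia.
- exists (j - i2.+1), i2; split; first lia.
  by split=> //; apply: (aK _ _ _ E i1) => //; lia.
- exists i1, (j - i1.+1); split; first lia.
  by split=> //; apply: (aL _ _ _ E i2) => //; lia.
Qed.

Lemma C_aperiodic_letter a : C_aperiodic (@lletter A a).
Proof.
exists unit, (fun=> tt); split.
  split=> // -[]; case: prevC => _ [_ [CT _]].
  by apply: C_ext CT.
exists 2 => u x y _ i j i2 j2; case: u => [|b u]; first by rewrite !wpow_nil.
rewrite /lletter => /(congr1 size); rewrite !size_cat size_wpow /=; nia.
Qed.

(** [eta] is the syntactic morphism of [L]: its classes are Boolean combinations of two-sided
    quotients of [L], and the positive powers of a word with idempotent image are all equivalent. *)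
Lemma C_aperiodic_base L : C L -> C_aperiodic L.
Proof.
move=> CL; have regL : regular L by case: prevC => H _; apply: H.
have [M [g Hg]] := finite_index_syn (finite_index_regular regL).
have cg : congruence g.
  move=> u u' v v' /Hg Eu /Hg Ev; apply/Hg => x y.
  by rewrite -!catA Eu catA Ev -catA.
exists M, g; split; first split=> // m.
  case: (EM (exists u, g u = m)) => [[u <-]|nm]; last first.
    case: prevC => _ [C0 _]; apply: C_ext C0 => w; split=> // E.
    by apply: nm; exists w.
  have [r Hr'] := finite_section g.
  have Hr x : syn L (r (g x)) x by apply/Hg/Hr'.
  (* finitely many contexts decide whether w is syntactically equivalent to u *)
  apply: (@C_ext (fun w => forall pq : M * M,
      L (r pq.1 ++ w ++ r pq.2) <-> L (r pq.1 ++ u ++ r pq.2))).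
    move=> w; split=> [H|/Hg H pq]; last exact: H.
    apply/Hg => x y.
    have Hctx z : L (x ++ z ++ y) <-> L (r (g x) ++ z ++ r (g y)).
      have H1 := Hr x [::] (z ++ y); have H2 := Hr y (r (g x) ++ z) [::].
      by rewrite /= in H1; rewrite -H1 -!catA !cats0 in H2 *; rewrite H2.
    by rewrite !Hctx; apply: (H (g x, g y)).
  apply: C_bigcap => pq.
  have CQ : C (fun w => L (r pq.1 ++ w ++ r pq.2)).
    case: prevC => _ [_ [_ [_ [_ [_ CQ]]]]].
    have [_ H] := CQ _ (r pq.2) (proj1 (CQ L (r pq.1) CL)).
    exact: H.
  case: (EM (L (r pq.1 ++ u ++ r pq.2))) => Lu.
    by apply: C_ext CQ => w; split=> // H; apply H.
  by apply: C_ext (C_compl CQ) => w; split=> [nL|H Lw]; [split|apply/Lu/H].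
exists 1 => u x y E i j i0 j0.
have Hp k : g (wpow u k.+1) = g u.
  elim: k => [|k IH]; first by rewrite wpow1.
  by rewrite wpowS -E; apply: cg.
case: i i0 => // i _; case: j j0 => // j _.
have /Hg H : g (wpow u i.+1) = g (wpow u j.+1) by rewrite !Hp.
by move/(H x y).
Qed.

Lemma SF_finite_index L : SF C L -> finite_index L.
Proof.
elim=> {L} [L CL|a|K L _ + _|K _|K L _ + _].
- by apply: finite_index_regular; case: prevC => H _; apply: H.
- exact: finite_index_letter.
- exact: finite_index_union.
- exact: finite_index_compl.
- exact: finite_index_concat.
Qed.

Lemma SF_C_aperiodic L : SF C L -> C_aperiodic L.
Proof.
elim=> {L} [L CL|a|K L _ + _|K _|K L _ + _].
- exact: C_aperiodic_base.
- exact: C_aperiodic_letter.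
- exact: C_aperiodic_union.
- exact: C_aperiodic_compl.
- exact: C_aperiodic_concat.
Qed.

End Control.

(** * Cutting languages of SD(C) by a map with finitely many values *)

Section Split.
Variables (A : finType) (C : lang A -> Prop).
Implicit Types (K L : lang A) (u v w : word A).

Lemma SD_ext K L : (forall w, K w <-> L w) -> SD C K -> SD C L.
Proof. by move/lang_ext ->. Qed.

Lemma SD_bigunion (I : finType) (F : I -> lang A) : (forall i, SD C (F i)) ->
  (forall i j w, F i w -> F j w -> i = j) -> SD C (fun w => exists i, F i w).
Proof.
move=> DF dF.
have H (s : seq I) : uniq s -> SD C (fun w => exists2 i, i \in s & F i w).
  elim: s => [_|i s IH] /=; first by apply: SD_ext (SD_empty C) => w; split=> // [] [].
  move=> /andP [nis /IH Ds].
  have dis : disjoint_langs (F i) (fun w => exists2 i, i \in s & F i w).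
    by move=> w [Fi [j js Fj]]; rewrite (dF _ _ _ Fi Fj) js in nis.
  apply: SD_ext (SD_union (DF i) Ds dis) => w; split.
    by case=> [Fi|[j js Fj]]; [exists i|exists j] => //; rewrite inE ?eqxx ?js ?orbT.
  case=> j; rewrite inE => /orP [/eqP -> Fi|js Fj]; first by left.
  by right; exists j.
apply: SD_ext (H (enum I) (enum_uniq I)) => w.
by split=> [[i _ Fi]|[i Fi]]; exists i => //; rewrite mem_enum.
Qed.

(** The invariant of the main induction, where [th] is an action on states; it is stronger than
    [SD C K]. *)
Definition SD_split (T : finType) (th : word A -> T) K :=
  forall t, SD C (fun w => K w /\ th w = t).

Lemma SD_split_pred (T : finType) (th : word A -> T) K (S : T -> Prop) :
  SD_split th K -> SD C (fun w => K w /\ S (th w)).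
Proof.
move=> spK; apply: (@SD_ext (fun w => exists t, S t /\ (K w /\ th w = t))).
  by move=> w; split=> [[t [St [Kw Et]]]|[Kw Sw]]; [rewrite Et|exists (th w)].
apply: SD_bigunion => [t|i j w [_ [_ <-]] [_ [_ <-]]//].
case: (EM (S t)) => St; first by apply: SD_ext (spK t) => w; split=> // [[]].
by apply: SD_ext (SD_empty C) => w; split=> // [[]].
Qed.

Lemma SD_split_SD (T : finType) (th : word A -> T) K : SD_split th K -> SD C K.
Proof.
move=> /(@SD_split_pred _ _ _ (fun=> True)) H.
by apply: SD_ext H => w; split=> [[]|].
Qed.

Lemma SD_split_comp (T T' : finType) (th : word A -> T) (th' : word A -> T')
  (phi : T -> T') K : (forall w, K w -> th' w = phi (th w)) ->
  SD_split th K -> SD_split th' K.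
Proof.
move=> E spK t; have := @SD_split_pred _ _ _ (fun s => phi s = t) spK.
by apply: SD_ext => w; split=> -[Kw <-]; rewrite E.
Qed.

Lemma SD_split_union (T : finType) (th : word A -> T) K L :
  disjoint_langs K L -> SD_split th K -> SD_split th L -> SD_split th (lunion K L).
Proof.
move=> dKL spK spL t.
have dis : disjoint_langs (fun w => K w /\ th w = t) (fun w => L w /\ th w = t).
  by move=> w [[Kw _] [Lw _]]; apply: (dKL w).
apply: SD_ext (SD_union (spK t) (spL t) dis) => w; rewrite /lunion; tauto.
Qed.

(** A piece is the union of the products of pieces over the pairs that [m] sends to [t]; unambiguity
    passes to these products and makes them disjoint. *)
Lemma SD_split_concat (T1 T2 T : finType) (th1 : word A -> T1) (th2 : word A -> T2)
  (th : word A -> T) (m : T1 -> T2 -> T) K L :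
  (forall u v, K u -> L v -> th (u ++ v) = m (th1 u) (th2 v)) ->
  unambiguous_concat K L ->
  SD_split th1 K -> SD_split th2 L -> SD_split th (lconcat K L).
Proof.
move=> Em unKL spK spL t.
pose F (p : T1 * T2) : lang A := fun w => m p.1 p.2 = t /\
  lconcat (fun u => K u /\ th1 u = p.1) (fun v => L v /\ th2 v = p.2) w.
apply: (@SD_ext (fun w => exists p, F p w)).
  move=> w; split=> [[[t1 t2] /= [Et [u [v [-> [[Ku E1] [Lv E2]]]]]]]|].
    by split; [exists u, v|rewrite Em // E1 E2].
  move=> [[u [v [-> [Ku Lv]]]] Et]; exists (th1 u, th2 v); split.
    by rewrite -Em.
  by exists u, v.
apply: SD_bigunion => [[t1 t2]|[t1 t2] [t1' t2'] w]; rewrite /F /=.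
  case: (EM (m t1 t2 = t)) => Et; last first.
    by apply: SD_ext (SD_empty C) => w; split=> // [[]].
  apply: (@SD_ext (lconcat (fun u => K u /\ th1 u = t1) (fun v => L v /\ th2 v = t2))).
    by move=> w; split=> // [[]].
  apply: SD_concat => // u u' v v' [Ku _] [Ku' _] [Lv _] [Lv' _].
  exact: unKL.
move=> [_ [u [v [-> [[Ku <-] [Lv <-]]]]]] [_ [u' [v' [E [[Ku' <-] [Lv' <-]]]]]].
by case: (unKL _ _ _ _ Ku Ku' Lv Lv' E) => -> ->.
Qed.

Lemma SD_split_inter (T : finType) (th : word A -> T) K (S : T -> Prop) :
  SD_split th K -> SD_split th (fun w => K w /\ S (th w)).
Proof.
move=> spK t; have := @SD_split_pred _ _ _ (fun s => S s /\ s = t) spK.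
by apply: SD_ext => w; rewrite and_assoc.
Qed.

End Split.

(** * Splitting P^* at the last factor that satisfies [c] *)

Section LastLetter.
Variables (A : finType) (P : lang A) (c : pred (word A)).
Hypotheses (codeP : prefix_code P) (sdP : bounded_sync_delay P).
Implicit Types (u v w : word A) (ws : seq (word A)).

Definition code_in : lang A := fun w => P w /\ c w.
Definition code_out : lang A := fun w => P w /\ ~~ c w.
(** In the factorization over [P], the last factor and no other satisfies [c]. *)
Definition block : lang A := lconcat (lstar code_out) code_in.

Lemma code_in_block w : code_in w -> block w.
Proof. by move=> Pw; exists [::], w; split=> //; split=> //; exact: lstar_nil. Qed.

Lemma code_out_star w : lstar code_out w -> lstar P w.
Proof. by apply: lstar_mono => u []. Qed.

Lemma block_star w : block w -> lstar P w.
Proof.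
by move=> [u [v [-> [/code_out_star Pu [Pv _]]]]]; apply: lstar_cat Pu (lstar_word Pv).
Qed.

(** Add factors on the left: one that satisfies [c] is a block by itself; any other joins the first
    block, or the tail if there is no block. *)
Lemma lstar_block w : lstar P w <-> lconcat (lstar block) (lstar code_out) w.
Proof.
split=> [|[k [b [-> [/(lstar_idem block_star) Pk /code_out_star Pb]]]]]; last first.
  exact: lstar_cat.
move: w; apply: lstar_ind.
  by exists [::], [::]; split=> //; split; exact: lstar_nil.
move=> p _ Pp _ [k [b [-> [Kk Bb]]]].
case: (boolP (c p)) => cp.
  exists (p ++ k), b; split; first by rewrite catA.
  by split=> //; apply: lstar_cat Kk; apply/lstar_word/code_in_block.
case: Kk => [[|k0 ks] [-> H]] /=.
  exists [::], (p ++ b); split=> //; split; first exact: lstar_nil.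
  exact: lstar_cat (lstar_word (conj Pp cp)) Bb.
exists (p ++ k0 ++ flatten ks), b; split; first by rewrite !catA.
split=> //; rewrite catA; apply: lstar_cat; last first.
  by exists ks; split=> // v vks; apply: H; rewrite inE vks orbT.
have [v [q [-> [Bv Pq]]]] : block k0 by apply: H; rewrite inE eqxx.
apply: lstar_word; rewrite catA; exists (p ++ v), q; split=> //; split=> //.
exact: lstar_cat (lstar_word (conj Pp cp)) Bv.
Qed.

Lemma block_factorization w : block w -> exists ws q,
  [/\ w = flatten (rcons ws q), forall u, u \in rcons ws q -> P u, c q & ~~ has c ws].
Proof.
move=> [_ [q [-> [[ws [-> H]] [Pq cq]]]]]; exists ws, q; split=> //.
- by rewrite flatten_rcons.
- by move=> u; rewrite mem_rcons inE => /orP [/eqP ->|/H []].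
- by apply/hasPn => u /H [].
Qed.

(** Since [find] returns the length when it fails, its value 0 says that [ws] is empty or ends with
    a factor satisfying [c]. *)
Lemma block_star_factorization w : lstar block w -> exists ws,
  [/\ w = flatten ws, forall u, u \in ws -> P u & find c (rev ws) = 0].
Proof.
move: w; apply: lstar_ind; first by exists [::].
move=> _ _ /block_factorization [ws [q [-> H cq _]]] _ [ws' [-> H' E]].
exists (rcons ws q ++ ws'); split; first by rewrite flatten_cat.
  by move=> u; rewrite mem_cat => /orP [/H|/H'].
rewrite rev_cat find_cat E rev_rcons /= cq size_rev.
case: ifP => // nh; move: E; rewrite hasNfind ?nh // size_rev => ->.
by [].
Qed.

Lemma code_out_factorization w : lstar code_out w -> exists ws,
  [/\ w = flatten ws, forall u, u \in ws -> P u & ~~ has c ws].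
Proof.
move=> [ws [-> H]]; exists ws; split=> // [u /H []//|].
by apply/hasPn => u /H [].
Qed.

(** The factorization over [P] is unique and a block stops at its first factor satisfying [c], so a
    block that begins another one has the same factors. *)
Lemma prefix_code_block : prefix_code block.
Proof.
split=> [w /block_factorization [ws [q [-> H cq _]]]|u v].
  rewrite flatten_rcons; case: q {cq} H => [|a q] H; last by case: (flatten ws).
  by case: (proj1 codeP [::]) => //; apply: H; rewrite mem_rcons inE eqxx.
move=> /block_factorization [ws [q [-> H cq nws]]] v0.
move=> /block_factorization [ws' [q' [E H' cq' nws']]].
have [s Es] := code_factorization_prefix codeP H H' E.
have := congr1 (find c) Es; rewrite -!cats1 -catA !find_cat.
rewrite (negbTE nws) (negbTE nws') /= cq cq' !addn0 => sz.
have := congr1 size Es; rewrite size_cat !size_rcons sz => szs.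
have s0 : s = [::] by apply/size0nil; lia.
move: E; rewrite Es s0 cats0 => /(congr1 size); rewrite size_cat.
by case: v v0 => //= a v _; lia.
Qed.

Lemma unambiguous_out_in : unambiguous_concat (lstar code_out) code_in.
Proof.
move=> u u' v v' /code_out_factorization [ws [-> H _]].
move=> /code_out_factorization [ws' [-> H' _]] [Pv _] [Pv' _].
rewrite -!flatten_rcons => /(code_factorization_inj codeP).
have aux s x : (forall u, u \in s -> P u) -> P x -> forall u, u \in rcons s x -> P u.
  by move=> Hs Px y; rewrite mem_rcons inE => /orP [/eqP ->|/Hs].
by move=> /(_ (aux _ _ H Pv) (aux _ _ H' Pv')) /rcons_inj [-> ->].
Qed.

(** The cut comes right after the last factor satisfying [c], if any, a position read off the unique
    factorization over [P]. *)
Lemma unambiguous_block_out : unambiguous_concat (lstar block) (lstar code_out).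
Proof.
move=> k k' b b' /block_star_factorization [ws [-> H E]].
move=> /block_star_factorization [ws' [-> H' E']].
move=> /code_out_factorization [bs [-> Hb nb]] /code_out_factorization [bs' [-> Hb' nb']].
rewrite -!flatten_cat => /(code_factorization_inj codeP).
have aux s s' : (forall u, u \in s -> P u) -> (forall u, u \in s' -> P u) ->
    forall u, u \in s ++ s' -> P u.
  by move=> Hs Hs' y; rewrite mem_cat => /orP [/Hs|/Hs'].
move=> /(_ (aux _ _ H Hb) (aux _ _ H' Hb')) Ews.
have := congr1 (fun s => find c (rev s)) Ews.
rewrite !rev_cat !find_cat !has_rev (negbTE nb) (negbTE nb') E E' !addn0 !size_rev => szb.
have szw : size ws = size ws'.
  by move: (congr1 size Ews); rewrite !size_cat szb => /addIn.
by move/eqP: Ews; rewrite eqseq_cat // => /andP [/eqP -> /eqP ->].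
Qed.

Lemma lplus_block u q : lstar P u -> code_in q -> lplus block (u ++ q).
Proof.
move=> /lstar_block [k [b [-> [Kk Bb]]]] Pq.
apply: lstar_lplus.
  case: q Pq => [[/(proj1 codeP)]//|a q] _.
  by case: (k ++ b).
by rewrite -catA; apply: lstar_cat Kk (lstar_word _); exists b, q.
Qed.

Lemma lpow_block n v : lpow block n v -> exists2 m, n <= m & lpow P m v.
Proof.
elim: n v => [|n IH] v.
  by move=> [ws [/size0nil -> [-> _]]]; exists 0 => //; exists [::].
case/lpow_S => b [v' [-> [Bb /IH [m nm Pv']]]].
case: Bb => u [q [-> [/code_out_star/lstar_lpow [m' Pu] [Pq _]]]].
exists (m' + 1 + m); first lia.
apply: lpow_cat Pv'; apply: lpow_cat Pu _.
exists [:: q]; rewrite /= cats0; split=> //; split=> // z.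
by rewrite inE => /eqP ->.
Qed.

(** The first [d] blocks hold at least [d] factors of [P]. By the delay of [P], all that precedes
    the last factor [q] of the extra block is in P^+, and [q], which satisfies [c], completes it to
    a product of blocks. *)
Lemma bounded_sync_delay_block : bounded_sync_delay block.
Proof.
case: sdP => d [d1 sd]; exists d.+1; split=> // u v w H.
rewrite -addn1 => /lpowD [v1 [b [Ev [/lpow_block [m dm Pv1] Bb]]]].
case: Bb => [[|b0 [|? ?]] [//= _ [Eb]]]; rewrite cats0 in Eb.
move=> /(_ b); rewrite -Eb inE eqxx => /(_ isT) [v2 [q [Ebq [Bv2 Pq]]]].
have [m' Pv2] := lstar_lpow (code_out_star Bv2).
have Evq : v = (v1 ++ v2) ++ q by rewrite Ev Ebq catA.
rewrite Evq catA; apply: (lplus_block _ Pq); apply: lplus_lstar.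
apply: (@sync_delay_ge _ P d (m + m') u (v1 ++ v2) (q ++ w) sd); first lia.
  apply: lstar_lplus; last first.
    by apply: (lstar_idem block_star); apply: lplus_lstar; rewrite [_ ++ q ++ w]catA -Evq.
  move=> E0; have : size q = 0 by move: (congr1 size E0); rewrite !size_cat /=; lia.
  by case: (q) Pq => // -[/(proj1 codeP)].
exact: lpow_cat.
Qed.

Lemma prefix_code_out : prefix_code code_out.
Proof.
case: codeP => P0 Pp; split=> [w [/P0]//|u v [Pu _] v0 [Puv _]].
exact: Pp Pu v0 Puv.
Qed.

Lemma bounded_sync_delay_out : bounded_sync_delay code_out.
Proof.
case: sdP => d [d1 sd]; exists d; split=> // u v w [ws [ws0 [E H]]] [vs [szv [Ev Hv]]].
have Puvw : lplus P (u ++ v ++ w) by exists ws; do 2!split=> //; move=> x /H [].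
have Pv : lpow P d v by exists vs; do 2!split=> //; move=> x /Hv [].
case: (sd _ _ _ Puvw Pv) => ws' [ws'0 [E' H']]; exists ws'; do 2!split=> //.
have [||s Es] := @code_factorization_prefix _ P ws' ws w codeP H' => [x /H []//||].
  by rewrite -E' -catA.
by move=> x xs; apply: H; rewrite Es mem_cat xs.
Qed.

End LastLetter.

(** * Idempotent powers in a finite quotient *)

Section IdempotentPower.
Variables (A N : finType) (eta : word A -> N).

(** By the pigeonhole principle the images of the powers of [u] have a period [p] from some exponent
    [i] on; a positive multiple of [p] that is at least [i] gives an idempotent. *)
Lemma idempotent_power (u : word A) : congruence eta ->
  exists2 m, 0 < m & eta (wpow u m ++ wpow u m) = eta (wpow u m).
Proof.
move=> ceta.
have [i [p [p0 Eip]]] : exists i p, 0 < p /\ eta (wpow u (i + p)) = eta (wpow u i).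
  have /injectivePn [i [j neq E]] : ~~ injectiveb (fun i : 'I_#|N|.+1 => eta (wpow u i)).
    by apply/injectiveP => /leq_card; rewrite card_ord ltnn.
  case: (ltngtP i j) => [ij|ji|/val_inj ij]; last by rewrite ij eqxx in neq.
    by exists i, (j - i); rewrite subn_gt0 subnKC // ltnW.
  by exists j, (i - j); rewrite subn_gt0 subnKC // ltnW.
have Ep k : i <= k -> eta (wpow u (k + p)) = eta (wpow u k).
  move=> /subnKC <-; rewrite addnAC wpowD [in RHS]wpowD; exact: ceta.
have Emp k t : i <= k -> eta (wpow u (k + t * p)) = eta (wpow u k).
  move=> ik; elim: t => [|t IH]; first by rewrite addn0.
  by rewrite mulSnr addnA Ep ?IH //; apply: leq_trans ik (leq_addr _ _).
exists (i.+1 * p); first by rewrite muln_gt0.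
rewrite -wpowD; apply: Emp; nia.
Qed.

End IdempotentPower.

(** * Actions on states and the induction for P^* *)

Section StarSplit.
Variables (A : finType) (C : lang A -> Prop).
Hypothesis prevC : prevariety C.
Variables (N : finType) (eta : word A -> N) (Q : finType) (delta : Q -> A -> Q).
Hypothesis Ceta : C_morphism C eta.
Variable n0 : nat.
Implicit Types (P : lang A) (X : {set Q}) (u v w : word A).

Definition run (q : Q) w := foldl delta q w.

Lemma run_cat q u v : run q (u ++ v) = run (run q u) v.
Proof. exact: foldl_cat. Qed.

(** Fixing the states outside [X] makes the map depend only on the action on [X]. *)
Definition act X w : {ffun Q -> Q} := [ffun q => if q \in X then run q w else q].

Definition act_comp (f g : {ffun Q -> Q}) : {ffun Q -> Q} := [ffun q => g (f q)].

Lemma act_in X w q : q \in X -> act X w q = run q w.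
Proof. by rewrite ffunE => ->. Qed.

Lemma act_cat X X' u v : X' \subset X -> {in X, forall q, run q u \in X'} ->
  act X (u ++ v) = act_comp (act X u) (act X' v).
Proof.
move=> /subsetP X'X H; apply/ffunP => q; rewrite !ffunE; case: ifP => qX.
  by rewrite H // run_cat.
by case: ifP => // /X'X; rewrite qX.
Qed.

Definition stable X P := forall w, P w -> {in X, forall q, run q w \in X}.

Lemma stable_star X P : stable X P -> stable X (lstar P).
Proof.
move=> st; apply: lstar_ind => // u v Pu _ IH q qX; rewrite run_cat.
by apply: IH; apply: st.
Qed.

Definition aperiodic_on X := forall u, eta (u ++ u) = eta u ->
  {in X, forall q, run q (wpow u n0) = run q (wpow u n0.+1)}.

Lemma injective_star X P : stable X P ->
  (forall w, P w -> {in X &, injective (run^~ w)}) ->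
  forall w, lstar P w -> {in X &, injective (run^~ w)}.
Proof.
move=> st inj; apply: lstar_ind => // u v Pu _ IH q q' qX q'X.
by rewrite !run_cat => /IH E; apply: (inj u) => //; apply: E; apply: st.
Qed.

Lemma lstar_wpow P u n : lstar P u -> lstar P (wpow u n).
Proof.
move=> Pu; elim: n => [|n IH]; first exact: lstar_nil.
by rewrite wpowS; apply: lstar_cat.
Qed.

(* If x and y have the same image under eta and P^* acts by permutations, then for
   a suitable m the word y x^(m-1) has an idempotent image, so it acts as the
   identity by aperiodicity, just as x x^(m-1) does. *)
Lemma permutation_action_eta X P x y : stable X P -> aperiodic_on X ->
  (forall w, P w -> {in X &, injective (run^~ w)}) ->
  lstar P x -> lstar P y -> eta x = eta y -> act X x = act X y.
Proof.
move=> st ap inj Px Py Exy.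
have stS := stable_star st; have injS := injective_star st inj.
have ceta := proj1 Ceta.
have idem z : lstar P z -> eta (z ++ z) = eta z -> {in X, forall q, run q z = q}.
  move=> Pz Ez q qX; have Pzn := lstar_wpow n0 Pz.
  apply: (injS _ Pzn) => //; first exact: stS.
  by rewrite -run_cat -wpowS -ap.
have [m m0 Em] := idempotent_power x ceta.
have Exm : wpow x m = x ++ wpow x m.-1 by rewrite -wpowS prednK.
have Pxm := lstar_wpow m.-1 Px.
have Eyx : eta (y ++ wpow x m.-1) = eta (wpow x m) by rewrite Exm; apply: ceta.
apply/ffunP => q; rewrite !ffunE; case: ifP => // qX.
apply: (injS _ Pxm); [exact: stS|exact: stS|].
rewrite /= -!run_cat !idem //; first exact: lstar_cat.
- by rewrite Eyx -Em; apply: ceta.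
- exact: lstar_cat.
- by rewrite -Exm.
Qed.

(** [T] bounds the set of maps induced by [P]: the inner induction removes [c] from it, and the
    outer one, on the size of [X], restarts with the full set. *)
Lemma SD_split_star X P (T : {set {ffun Q -> Q}}) :
  prefix_code P -> bounded_sync_delay P -> stable X P -> aperiodic_on X ->
  (forall w, P w -> act X w \in T) ->
  SD_split C (act X) P -> SD_split C (act X) (lstar P).
Proof.
have [k] := ubnP #|X|; elim: k X P T => // k IHX X P T.
have [m] := ubnP #|T|; elim: m P T => // m IHT P T Tm Xk codeP sdP stP apX PT spP.
case: (boolP [forall (t | t \in T), dinjectiveb t X]) => [/forall_inP injT|].
  have inj w : P w -> {in X &, injective (run^~ w)}.
    move=> /PT /injT /dinjectiveP H q q' qX q'X E.
    by apply: H; rewrite // !act_in.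
  (* The action is now a function of [eta], so the words acting as [t] are those of P^* whose image
     lies in [S]. *)
  move=> t; pose S n := exists x, [/\ lstar P x, eta x = n & act X x = t].
  have DS : SD C (lstar P) by apply: SD_star => //; exact: SD_split_SD spP.
  apply: SD_ext (SD_inter DS (C_morphism_pred prevC S Ceta)) => w.
  split=> [[Pw [x [Px Ex Et]]]|[Pw Et]]; last by split=> //; exists w.
  by split=> //; rewrite -Et; apply: (@permutation_action_eta X P).
(* otherwise split the words of P^* at their last factor acting like c *)
rewrite negb_forall_in => /exists_inP [c cT ninj].
pose isc w := act X w == c.
(* [c] is any member of [T], perhaps not induced by [P]; intersecting with [X] makes [X'] a subset
   of [X] in all cases. *)
pose X' := (c @: X) :&: X.
have X'X : X' \subset X by exact: subsetIr.
have X'lt : #|X'| < #|X|.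
  apply: leq_ltn_trans (subset_leq_card (subsetIl _ _)) _.
  rewrite ltn_neqAle leq_imset_card andbT; apply: contra ninj => /imset_injP H.
  exact/dinjectiveP.
have stOut : stable X (lstar (code_out P isc)).
  by apply: stable_star => w [/stP].
have spOut : SD_split C (act X) (lstar (code_out P isc)).
  apply: (IHT (code_out P isc) (T :\ c)) => //.
  - by move: Tm; rewrite (cardsD1 c) cT; lia.
  - exact: prefix_code_out.
  - exact: bounded_sync_delay_out.
  - by move=> w [/stP].
  - by move=> w [/PT Tw nc]; rewrite !inE nc.
  - exact: (SD_split_inter (fun t => t != c) spP).
have inX' w : block P isc w -> {in X, forall q, run q w \in X'}.
  move=> [u [v [-> [Bu [Pv /eqP Ec]]]]] q qX; rewrite run_cat.
  have uX : run q u \in X by apply: stOut.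
  rewrite !inE stP // andbT -Ec; apply/imsetP; exists (run q u) => //.
  by rewrite act_in.
have stBlock' : stable X' (block P isc).
  by move=> w Bw q /(subsetP X'X); apply: inX'.
have spBlock : SD_split C (act X) (block P isc).
  apply: (SD_split_concat (m := act_comp)) spOut _.
  - by move=> u v Bu _; apply: act_cat => //; apply: stOut.
  - exact: unambiguous_out_in.
  - exact: (SD_split_inter (fun t => t == c) spP).
have spBlock' : SD_split C (act X') (lstar (block P isc)).
  apply: (IHX X' (block P isc) setT) => //.
  - exact: leq_trans X'lt Xk.
  - exact: prefix_code_block.
  - exact: bounded_sync_delay_block.
  - by move=> u Eu q /(subsetP X'X); apply: apX.
  - by move=> w _; rewrite inE.
  - apply: (SD_split_comp (phi := fun t : {ffun Q -> Q} =>
      [ffun q => if q \in X' then t q else q])) spBlock => w _.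
    apply/ffunP => q; rewrite !ffunE; case: ifP => // /(subsetP X'X) ->//.
have unBO := @unambiguous_block_out _ P isc codeP.
have codeB := @prefix_code_block _ P isc codeP.
(* The action of products of blocks is controlled on [X'] only, so a first block, which brings [X]
   into [X'], is split off; the words without a block are treated apart. *)
pose tail := lconcat (lstar (block P isc)) (lstar (code_out P isc)).
have spTail : SD_split C (act X') tail.
  apply: (SD_split_concat (m := fun f g : {ffun Q -> Q} =>
    [ffun q => if q \in X' then g (f q) else q])) unBO spBlock' spOut => u v Bu _.
  apply/ffunP => q; rewrite !ffunE; case: ifP => // qX'.
  by rewrite run_cat (subsetP X'X) // (stable_star stBlock').
have spRest : SD_split C (act X) (lconcat (block P isc) tail).
  apply: (SD_split_concat (m := act_comp)) spBlock spTail.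
    by move=> u v Bu _; apply: act_cat => //; apply: inX'.
  exact: prefix_code_unambiguous.
have dis : disjoint_langs (lstar (code_out P isc)) (lconcat (block P isc) tail).
  move=> w [Ow [p [x [Ew [Bp [k' [b [Ex [Bk' Ob]]]]]]]]].
  have Bpk' := lstar_cat (lstar_word Bp) Bk'.
  have [|E _] := unBO _ _ _ _ (lstar_nil _) Bpk' Ow Ob; first by rewrite /= Ew Ex catA.
  by apply: (proj1 codeB _ Bp); case: (p) E.
suff -> : lstar P = lunion (lstar (code_out P isc)) (lconcat (block P isc) tail).
  exact: SD_split_union.
apply: lang_ext => w; rewrite (lstar_block P isc); split.
  move=> [p [b [-> [[[|k0 ks] [-> H]] Ob]]]]; first by left.
  right; exists k0, (flatten ks ++ b); split; first by rewrite /= catA.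
  split; first by apply: H; rewrite inE eqxx.
  exists (flatten ks), b; split=> //; split=> //; exists ks; split=> // v vks.
  by apply: H; rewrite inE vks orbT.
case=> [Ow|[p [_ [-> [Bp [k' [b [-> [Bk' Ob]]]]]]]]].
  by exists [::], w; split=> //; split=> //; exact: lstar_nil.
exists (p ++ k'), b; split; first by rewrite catA.
by split=> //; apply: lstar_cat (lstar_word Bp) Bk'.
Qed.

End StarSplit.

(** * SF(C) is contained in SD(C) *)

Section SFinSD.
Variables (A : finType) (C : lang A -> Prop).
Hypothesis prevC : prevariety C.

Definition letters : lang A := fun w => size w = 1.

Lemma lstar_letters w : lstar letters w.
Proof.
elim: w => [|a w IH]; first exact: lstar_nil.
by apply: (@lstar_cat _ _ [:: a]) IH; apply: lstar_word.
Qed.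

Lemma prefix_code_letters : prefix_code letters.
Proof.
split=> [w|u v]; first by case: w.
by rewrite /letters size_cat => ->; case: v.
Qed.

Lemma bounded_sync_delay_letters : bounded_sync_delay letters.
Proof.
exists 1; split=> // u v w _ [[|p [|? ?]] [//= _ [Ev H]]].
apply: lstar_lplus (lstar_letters _); rewrite Ev cats0.
have : letters p by apply: H; rewrite inE eqxx.
by case: (p) => // a p' _; case: (u).
Qed.

Lemma SD_split_letters (T : finType) (th : word A -> T) : SD_split C th letters.
Proof.
move=> t; apply: (@SD_ext _ _ (fun w => exists a, th [:: a] = t /\ lletter a w)).
  move=> w; split=> [[a [Et ->]]|[]] //.
  by case: w => [|a [|? ?]] // _ Et; exists a.
apply: SD_bigunion => [a|a b w [_ ->] [_ [->]]//].
case: (EM (th [:: a] = t)) => E.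
  by apply: SD_ext (SD_letter C a) => w; split=> // [[]].
by apply: SD_ext (SD_empty C) => w; split=> // [[]].
Qed.

Lemma SF_sub_SD L : SF C L -> SD C L.
Proof.
move=> FL; have [N [eta [Ceta [n apL]]]] := SF_C_aperiodic prevC FL.
have [Q0 [f Hf]] := SF_finite_index prevC FL.
(* [st] maps a word to its state in the minimal automaton of [L]; [r] will pick a word leading to
   each state. *)
have [st Hst] : exists st : word A -> Q0, forall u v,
    st u = st v <-> forall w, L (u ++ w) <-> L (v ++ w).
  apply: (finite_quotient (f := f)) => //.
  - by move=> u v H w; rewrite H.
  - by move=> u v x H1 H2 w; rewrite H1 H2.
  - by move=> u v E w; split; apply: Hf.
have [r Hr] := finite_section st.
pose delta q a := st (r q ++ [:: a]).
have st_run u w : run delta (st u) w = st (u ++ w).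
  elim/last_ind: w => [|w a IH]; first by rewrite cats0.
  rewrite -cats1 run_cat IH /= /delta; apply/Hst => v.
  by have /Hst H := Hr (u ++ w); rewrite -catA H !catA.
(* This discards the elements of [Q0] that no word reaches. *)
pose X := [set q | st (r q) == q].
have stX u : st u \in X by rewrite inE Hr.
have spX : SD_split C (act delta X) (lstar letters).
  apply: (@SD_split_star _ _ prevC _ _ _ _ Ceta n X letters setT) => //.
  - exact: prefix_code_letters.
  - exact: bounded_sync_delay_letters.
  - by move=> w _ q; rewrite inE => /eqP <-; rewrite st_run.
  - move=> u Eu q; rewrite inE => /eqP <-; rewrite !st_run.
    have Ecat i w : (r q ++ wpow u i) ++ w = r q ++ wpow u i ++ w by rewrite catA.
    by apply/Hst => w; rewrite !Ecat; split; apply: (apL _ _ _ Eu).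
  - by move=> w _; rewrite inE.
  - exact: SD_split_letters.
(* [L] consists of the words whose action sends the initial state [st [::]] to a final state. *)
have := @SD_split_pred _ _ _ _ _ (fun t : {ffun Q0 -> Q0} => L (r (t (st [::])))) spX.
apply: SD_ext => w; rewrite act_in // st_run /=.
have /Hst /(_ [::]) := Hr w; rewrite !cats0 => ->.
by split=> [[]|] //; split=> //; exact: lstar_letters.
Qed.

End SFinSD.

Theorem theorem4p10 (A : finType) (C : lang A -> Prop) :
  prevariety C -> SD C = SF C.
Proof.
move=> prevC; apply/predeqP => L; split; first exact: SD_sub_SF.
exact: SF_sub_SD.
Qed.
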